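(* Let $k\ge 3$ and let $K$ be a two-bridge link of Conway normal form $C(m_1,\dots,m_k)$, where $m_i>0$ for all $i$, $m_1\ge 2$ and $m_k\ge 2$. Then $K$ possesses an awkward trigonal diagram.
   Context: Trigonal diagrams. For a finite (possibly empty) sequence of integers $m_1,\dots,m_k$ (zero allowed), $D(m_1,\dots,m_k)$ is the following diagram of a long link (Conway's open form, also called trigonal form). Take three horizontal strand positions $1,2,3$ across a vertical strip in the plane. At the left, position $1$ runs to infinity and positions $2,3$ are joined by a cap. Reading from left to right one inserts successively $|m_1|$ half-twists (crossings) on positions $1,2$, then $|m_2|$ half-twists on positions $2,3$, then $|m_3|$ on positions $1,2$, and so on, alternately. At the right, if $k$ is odd, position $1$ runs to infinity and positions $2,3$ are joined by a cap; if $k$ is even, position $3$ runs to infinity and positions $1,2$ are joined by a cap. Sign convention: for $i$ odd, $m_i>0$ means right-handed half-twists; for $i$ even, $m_i>0$ means left-handed half-twists. Thus a diagram whose $m_i$ all have the same sign is alternating. (Positions $1,2,3$ may be numbered from top to bottom or from bottom to top; the two resulting diagrams are exchanged by a half-turn of space about the horizontal axis and carry the same Conway notation.) Joining the two infinite ends gives an (unoriented) two-bridge link in the usual sense. A trigonal diagram is a diagram of this form. Conway's normal form. A link is of Conway's normal form $C(m_1,\dots,m_k)$, where the $m_i$ all have the same sign, if it admits the (alternating) diagram $D(m_1,\dots,m_k)$. Slide isotopies. An isotopy of trigonal diagrams (a finite sequence of planar isotopies and Reidemeister moves) is a slide isotopy if the number of crossings never increases and all the intermediate diagrams remain trigonal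 (planar isotopies being through diagrams of this three-strand type). Complexity. The complexity of $D(m_1,\dots,m_k)$ is $c(D)=k+\sum_{i=1}^k|m_i|$. Simple and awkward diagrams. A trigonal diagram is simple if it cannot be transformed into a trigonal diagram of lower complexity by using slide isotopies only. A non-alternating simple diagram is called awkward. *)

(* Defs.v *)
From HB Require Import structures.
From mathcomp Require Import all_boot all_order all_algebra.
From Stdlib Require Import Relation_Operators.

Set Implicit Arguments.
Unset Strict Implicit.
Unset Printing Implicit Defensive.

(* A plane diagram in general position with respect to the horizontal
   coordinate is given by its elementary events, read from left to right.
   Between two events the diagram consists of horizontal strands, numbered
   0, 1, 2, ... from top to bottom. *)

Inductive event :=
  | Birth of nat           (* an arc open to the right, its ends at i, i+1 *)
  | Death of nat           (* the strands i and i+1 are joined by a cap *)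
  | Cross of nat & bool.   (* the strands i and i+1 cross; [true] when the
                              strand entering at i (going down) is the over
                              strand: a right-handed half-twist of the two
                              horizontal strands *)

Definition pos (e : event) : nat :=
  match e with Birth i | Death i | Cross i _ => i end.

Definition arity_in (e : event) : nat := if e is Birth _ then 0 else 2.
Definition arity_out (e : event) : nat := if e is Death _ then 0 else 2.

Definition reposition (f : nat -> nat) (e : event) : event :=
  match e with
  | Birth i => Birth (f i)
  | Death i => Death (f i)
  | Cross i s => Cross (f i) s
  end.

Definition is_cross (e : event) : bool := if e is Cross _ _ then true else false.

(* Number of strands on the right of [w], starting from [n] strands; [None] if
   some event takes place at a position where it makes no sense. *)
Fixpoint run (n : nat) (w : seq event) : option nat :=
  if w is e :: w' then
    if pos e + arity_in e <= n then run (n - arity_in e + arity_out e) w'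
    else None
  else Some n.

Definition is_diagram (a b : nat) (w : seq event) : Prop := run a w = Some b.

Definition ncross (w : seq event) : nat := count is_cross w.

(* Elementary planar isotopies: events taking place at disjoint heights are
   exchanged, a zigzag is straightened, or a crossing slides through the
   vertical tangent of a cap. *)
Inductive planar_move : seq event -> seq event -> Prop :=
  | exchange e f : pos e + arity_out e <= pos f ->
      planar_move [:: e; f]
        [:: reposition (fun j => j - arity_out e + arity_in e) f; e]
  | zigzag_down i : planar_move [:: Birth i; Death i.+1] [::]
  | zigzag_up i : planar_move [:: Birth i.+1; Death i] [::]
  | tip_left i s :
      planar_move [:: Birth i; Cross i.+1 s] [:: Birth i.+1; Cross i (~~ s)]
  | tip_right i s :
      planar_move [:: Cross i.+1 s; Death i] [:: Cross i (~~ s); Death i.+1].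

(* In [R3], a, b, c are the crossings of the strands entering at (i, i+1),
   (i, i+2), (i+1, i+2).  The excluded sign patterns are those for which "passes
   over" is cyclic on the three strands.  The forms of the Reidemeister moves
   not listed here follow from these and the planar isotopies. *)
Inductive reidemeister_move : seq event -> seq event -> Prop :=
  | R1_left i s : reidemeister_move [:: Birth i; Cross i s] [:: Birth i]
  | R1_right i s : reidemeister_move [:: Cross i s; Death i] [:: Death i]
  | R2 i s : reidemeister_move [:: Cross i s; Cross i (~~ s)] [::]
  | R3 i a b c : (b == a) || (b == c) ->
      reidemeister_move [:: Cross i a; Cross i.+1 b; Cross i c]
                        [:: Cross i.+1 c; Cross i b; Cross i.+1 a].

Inductive move (a b : nat) : seq event -> seq event -> Prop :=
  | Move p q l r :
      planar_move l r \/ reidemeister_move l r ->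
      is_diagram a b (p ++ l ++ q) -> is_diagram a b (p ++ r ++ q) ->
      move a b (p ++ l ++ q) (p ++ r ++ q).

(* A link, given by one of its diagrams; two diagrams represent the same link
   when they are [isotopic 0 0] (Reidemeister's theorem). *)
Record link := Link {
  link_diagram : seq event;
  link_diagramP : is_diagram 0 0 link_diagram
}.

Definition isotopic (a b : nat) : seq event -> seq event -> Prop :=
  clos_refl_sym_trans (seq event) (move a b).

(* Joins the two infinite ends of a long link diagram by an arc passing above
   the diagram. *)
Definition link_closure (w : seq event) : seq event :=
  Birth 0 :: map (reposition S) w ++ [:: Death 0].

(* Alternating diagrams.  The point (t, i) is the point of strand i between the
   events number t - 1 and t; [same_edge w] relates points that can be joined
   along the diagram without going through a crossing. *)
Definition point : Type := (nat * nat)%type.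

Inductive edge_step (w : seq event) : point -> point -> Prop :=
  | step_above t e i : onth w t = Some e -> i < pos e ->
      edge_step w (t, i) (t.+1, i)
  | step_below t e i : onth w t = Some e ->
      edge_step w (t, pos e + arity_in e + i) (t.+1, pos e + arity_out e + i)
  | step_birth t i : onth w t = Some (Birth i) ->
      edge_step w (t.+1, i) (t.+1, i.+1)
  | step_death t i : onth w t = Some (Death i) ->
      edge_step w (t, i) (t, i.+1).

Definition same_edge (w : seq event) : point -> point -> Prop :=
  clos_refl_sym_trans point (edge_step w).

(* The four half-edges at each crossing.  The boolean of a half-edge tells
   whether it leaves the crossing on the right; the last argument tells whether
   it belongs to the over strand. *)
Inductive half_edge (w : seq event) : point * bool -> bool -> Prop :=
  | enter_upper t i s : onth w t = Some (Cross i s) ->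
      half_edge w ((t, i), false) s
  | enter_lower t i s : onth w t = Some (Cross i s) ->
      half_edge w ((t, i.+1), false) (~~ s)
  | leave_lower t i s : onth w t = Some (Cross i s) ->
      half_edge w ((t.+1, i.+1), true) s
  | leave_upper t i s : onth w t = Some (Cross i s) ->
      half_edge w ((t.+1, i), true) (~~ s).

Definition alternating (w : seq event) : Prop :=
  forall (h h' : point * bool) (o o' : bool),
    half_edge w h o -> half_edge w h' o' -> h <> h' ->
    same_edge w h.1 h'.1 -> o <> o'.

(* D(m_1, ..., m_k), drawn with the positions 1, 2, 3 numbered from top to
   bottom, or from bottom to top when [flipped]. *)
Record trigonal := Trigonal { flipped : bool; conway : seq int }.

(* Upper strand of the positions 1,2 (resp. of the positions 2,3). *)
Definition pos12 (flip : bool) : nat := if flip then 1 else 0.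
Definition pos23 (flip : bool) : nat := if flip then 0 else 1.

(* [odd_index] is the parity of the index of the first entry. *)
Fixpoint twists (flip odd_index : bool) (m : seq int) : seq event :=
  if m is a :: m' then
    nseq `|a|%N (Cross (if odd_index then pos12 flip else pos23 flip)
                       (if odd_index then (0 < a)%R else (a < 0)%R))
    ++ twists flip (~~ odd_index) m'
  else [::].

Definition diagram (D : trigonal) : seq event :=
  let: Trigonal flip m := D in
  Birth (pos23 flip) :: twists flip true m ++
    [:: Death (if odd (size m) then pos23 flip else pos12 flip)].

Definition is_trigonal (w : seq event) : Prop := exists D, w = diagram D.

Definition complexity (D : trigonal) : nat :=
  size (conway D) + \sum_(a <- conway D) `|a|%N.

(* The only planar isotopies between trigonal diagrams are [tip_left] and
   [tip_right]. *)
Definition slide_step (v w : seq event) : Prop :=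
  [/\ is_trigonal v, is_trigonal w, move 1 1 v w \/ move 1 1 w v
    & ncross w <= ncross v].

Definition slide_isotopy : seq event -> seq event -> Prop :=
  clos_refl_trans (seq event) slide_step.

Definition simple (D : trigonal) : Prop :=
  forall E : trigonal, slide_isotopy (diagram D) (diagram E) ->
    complexity D <= complexity E.

Definition awkward (D : trigonal) : Prop :=
  simple D /\ ~ alternating (diagram D).

Definition possesses (K : link) (D : trigonal) : Prop :=
  isotopic 0 0 (link_diagram K) (link_closure (diagram D)).

Definition same_sign (m : seq int) : bool :=
  all (fun a => 0 < a)%R m || all (fun a => a < 0)%R m.

Definition conway_normal_form (K : link) (m : seq int) : Prop :=
  same_sign m /\ exists flip, possesses K (Trigonal flip m).

(* Main.v *)
Require Import Defs.
From mathcomp Require Import all_boot all_order all_algebra.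
From mathcomp Require Import zify.
From Stdlib Require Import Relation_Operators Classical_Prop.

Set Implicit Arguments.
Unset Strict Implicit.
Unset Printing Implicit Defensive.

(** Write a and b for a right-handed half-twist on the positions 1,2 and on the
    positions 2,3, and A, B for their inverses. A trigonal diagram is a cap, a
    word in these four letters, and a cap; it is alternating as soon as only
    a and B, or only A and b, occur. So C(m1, ..., mk) is drawn by the word
    a^m1 B^m2 a^m3 B^m4 ...

    The half twist BAB conjugates a to b and is absorbed by the cap on the right,
    which it moves from one pair of positions to the other. As B = ab.BAB, a
    letter B can be replaced with ab, at the price of exchanging a and b in the
    rest of the word ([resolve_crossing]). Doing this to the m2 letters B^m2
    gives another diagram of the same link ([untwist_iso]), with the word

      a^(m1+1) b^2 a^2 b^2 ... x^(m3+1) Y^m4 x^m5 ...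

    where m2 - 1 squares stand between a^(m1+1) and x^(m3+1), x is the next of
    a and b in turn, and Y is the inverse of the other one: in Conway's
    notation, D(m1 + 1, -2, 2, ..., e (m3 + 1), e m4, e m5, ...), where e is
    1 or -1.
    It contains the factor ab, hence is not alternating.

    Slides can hardly change this word. A cancellation needs two adjacent
    inverse letters; a third Reidemeister move needs a factor of three letters
    in which the middle one is alone between two letters on the other pair of
    positions and has the handedness of one of them. There is none: the powers
    before the tail have exponents at least 2, and the tail, from x^(m3+1) on,
    is alternating. What remains is to slide the first or the last crossing
    through the tip of the adjacent cap, which replaces that letter with the
    inverse of the other generator. Since m1 + 1 >= 3, and since the last letter
    belongs to the alternating tail and comes after its first two letters, this
    creates no new possibility. Thus the slide orbit consists of four words
    ([slide_tight]), all of which contain ab. None of them is alternating, and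
    one of minimal complexity is awkward ([awkward_of_orbit]). *)

(** * Trigonal diagrams as words *)

(** The position of the upper strand of a crossing, [false] for the upper two
    strands, and its handedness, as in [Cross]. *)
Definition letter := (bool * bool)%type.

Definition crossing (x : letter) : event := Cross x.1 x.2.

Definition strip (b : bool) (w : seq letter) (d : bool) : seq event :=
  Birth b :: map crossing w ++ [:: Death d].

(** [twists] as a word; tracking the current position [p] instead of the
    orientation of the diagram makes both orientations instances of one
    recursion. *)
Fixpoint letters (p odd : bool) (m : seq int) : seq letter :=
  if m is a :: m' then
    nseq `|a|%N (p, if odd then (0 < a)%R else (a < 0)%R)
    ++ letters (~~ p) (~~ odd) m'
  else [::].

Lemma twistsE flip odd m :
  twists flip odd m = map crossing (letters (~~ odd (+) flip) odd m).
Proof.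
elim: m odd => [|a m IH] odd //=.
by rewrite IH map_cat map_nseq; case: odd; case: (flip).
Qed.

Lemma diagramE flip m :
  diagram (Trigonal flip m) =
  strip (~~ flip) (letters flip true m) (flip (+) odd (size m)).
Proof.
rewrite /diagram /strip twistsE /=.
by case: (odd _); case: flip.
Qed.

Lemma trigonal_strip v : is_trigonal v -> exists b w d, v = strip b w d.
Proof. by case=> -[flip m] ->; rewrite diagramE; do 3! eexists. Qed.

(** * Isotopies of long links *)

Lemma run_cat n u v : run n (u ++ v) = obind (run^~ v) (run n u).
Proof. by elim: u n => //= e u IH n; case: ifP. Qed.

Lemma run_crossings w : run 3 (map crossing w) = Some 3.
Proof. by elim: w => //= -[[] s] w. Qed.

Lemma strip_is_diagram b w d : is_diagram 1 1 (strip b w d).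
Proof.
by rewrite /is_diagram /strip; case: b; rewrite /= run_cat run_crossings; case: d.
Qed.

Lemma move_strip b d u b' d' u' l r p q :
  planar_move l r \/ reidemeister_move l r ->
  strip b u d = p ++ l ++ q -> strip b' u' d' = p ++ r ++ q ->
  isotopic 1 1 (strip b u d) (strip b' u' d').
Proof.
move=> lr E E'; apply: rst_step.
have := strip_is_diagram b u d; have := strip_is_diagram b' u' d'.
by rewrite E E' => h h'; apply: Move.
Qed.

Definition iso := isotopic 1 1.

Lemma iso_refl v : iso v v.
Proof. exact: rst_refl. Qed.

Lemma iso_sym v w : iso v w -> iso w v.
Proof. exact: rst_sym. Qed.

Lemma iso_trans w v z : iso v w -> iso w z -> iso v z.
Proof. exact: rst_trans. Qed.

(** Stands for the equality of three-strand braids; quantifying over the strip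
    makes it a congruence. *)
Definition braid_eq (l r : seq letter) := forall b u v d,
  iso (strip b (u ++ l ++ v) d) (strip b (u ++ r ++ v) d).

Lemma braid_eq_move l r :
  reidemeister_move (map crossing l) (map crossing r) -> braid_eq l r.
Proof.
move=> lr b u v d.
apply: (move_strip (p := Birth b :: map crossing u)
  (q := map crossing v ++ [:: Death d]) (or_intror lr));
by rewrite /strip !map_cat /= !catA.
Qed.

Lemma braid_eq_sym l r : braid_eq l r -> braid_eq r l.
Proof. by move=> lr b u v d; exact: iso_sym (lr _ _ _ _). Qed.

Lemma braid_eq_trans r l t : braid_eq l r -> braid_eq r t -> braid_eq l t.
Proof. by move=> lr rt b u v d; apply: iso_trans (lr _ _ _ _) (rt _ _ _ _). Qed.

Lemma braid_eq_ctx u v l r : braid_eq l r -> braid_eq (u ++ l ++ v) (u ++ r ++ v).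
Proof.
move=> lr b u' v' d; have := lr b (u' ++ u) (v ++ v') d.
by rewrite -!catA.
Qed.

(** * Pulling half twists to the right *)

Definition half_twist (q : bool) : seq letter :=
  [:: (q, false); (~~ q, false); (q, false)].

Definition swap (x : letter) : letter := (~~ x.1, x.2).

Lemma braid_eq_cancel q s : braid_eq [:: (q, s); (q, ~~ s)] [::].
Proof. by apply: braid_eq_move; apply: R2. Qed.

Lemma half_twist_swap q : braid_eq (half_twist q) (half_twist (~~ q)).
Proof.
have H : braid_eq (half_twist false) (half_twist true).
  by apply: braid_eq_move; apply: (@R3 0 false false false).
by case: q => //; apply: braid_eq_sym.
Qed.

(** If the letter is on the same pair of strands as the last letter of the half
    twist, it either cancels or completes another half twist that starts one
    letter later; in the other case the half twist is first rewritten to end on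
    the right pair. *)
Lemma half_twist_letter q x :
  braid_eq (half_twist q ++ [:: x]) (swap x :: half_twist q).
Proof.
(* The case where the half twist ends on the pair of strands of the letter. *)
have H p s : braid_eq (half_twist p ++ [:: (p, s)]) ((~~ p, s) :: half_twist p).
  case: s.
    apply: (@braid_eq_trans [:: (p, false); (~~ p, false)]).
      exact: (@braid_eq_ctx [:: (p, false); (~~ p, false)] [::] _ _
                (braid_eq_cancel p false)).
    apply: braid_eq_sym.
    apply: (@braid_eq_trans ((~~ p, true) :: half_twist (~~ p))).
      have := @braid_eq_ctx [:: (~~ p, true)] [::] _ _ (half_twist_swap p).
      by rewrite !cats0.
    rewrite /half_twist negbK.
    exact: (@braid_eq_ctx [::] [:: (p, false); (~~ p, false)] _ _
              (braid_eq_cancel (~~ p) true)).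
  have := @braid_eq_ctx [::] [:: (p, false)] _ _ (half_twist_swap p).
  by rewrite /half_twist /= negbK.
case: x => p s; case: (eqVneq p q) => [-> | pq]; first exact: H.
have -> : p = ~~ q by move: pq; case: p; case: q.
apply: (@braid_eq_trans (half_twist (~~ q) ++ [:: (~~ q, s)])).
  exact: (@braid_eq_ctx [::] _ _ _ (half_twist_swap q)).
apply: braid_eq_trans (H (~~ q) s) _; rewrite /swap /= negbK.
have := @braid_eq_ctx [:: (q, s)] [::] _ _ (half_twist_swap (~~ q)).
by rewrite !cats0 negbK.
Qed.

Lemma half_twist_word q v :
  braid_eq (half_twist q ++ v) (map swap v ++ half_twist q).
Proof.
elim: v => [|x v IH]; first by rewrite cats0 => b u v d; apply: iso_refl.
apply: (@braid_eq_trans (swap x :: half_twist q ++ v)).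
  exact: (@braid_eq_ctx [::] v _ _ (half_twist_letter q x)).
have := @braid_eq_ctx [:: swap x] [::] _ _ IH.
by rewrite !cats0.
Qed.

(** Sliding the last crossing through the tip of the cap makes it cancel the
    previous one, and the crossing left is a curl. *)
Lemma half_twist_absorbed b u d :
  iso (strip b (u ++ half_twist (~~ d)) d) (strip b u (~~ d)).
Proof.
apply: (@iso_trans (strip b (u ++ [:: (~~ d, false); (d, false); (d, true)]) (~~ d))).
  have E e c : strip b (u ++ [:: (~~ d, false); (d, false); c]) e =
    (Birth b :: map crossing (u ++ [:: (~~ d, false); (d, false)]))
    ++ [:: crossing c; Death e] ++ [::].
    by rewrite /strip !map_cat /= -!catA.
  rewrite /half_twist negbK; case: d E => E.
    apply: iso_sym.
    by apply: (move_strip (or_introl (tip_right 0 true))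
                 (E false (true, true)) (E true (false, false))).
  by apply: (move_strip (or_introl (tip_right 0 false))
               (E false (true, false)) (E true (false, true))).
apply: (@iso_trans (strip b (u ++ [:: (~~ d, false)]) (~~ d))).
  have := @braid_eq_ctx [:: (~~ d, false)] [::] _ _ (braid_eq_cancel d false)
            b u [::] (~~ d).
  by rewrite !cats0.
apply: (move_strip (p := Birth b :: map crossing u) (q := [::])
  (or_intror (R1_right (~~ d) false))) => //.
by rewrite /strip map_cat -catA.
Qed.

(** Here B = ab.BAB; the half twist BAB is pulled through [v], exchanging the
    pairs of strands there, and is absorbed by the cap. *)
Lemma resolve_crossing b u q v d :
  iso (strip b (u ++ (q, false) :: v) d)
      (strip b (u ++ [:: (~~ q, true), (q, true) & map swap v]) (~~ d)).
Proof.
have E : braid_eq [:: (q, false)] ([:: (~~ q, true); (q, true)] ++ half_twist q).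
  apply: braid_eq_sym.
  apply: (@braid_eq_trans [:: (~~ q, true); (~~ q, false); (q, false)]).
    exact: (@braid_eq_ctx [:: (~~ q, true)] [:: (~~ q, false); (q, false)] _ _
              (braid_eq_cancel q true)).
  exact: (@braid_eq_ctx [::] [:: (q, false)] _ _ (braid_eq_cancel (~~ q) true)).
apply: iso_trans (E b u v d) _ => {E}.
have := half_twist_word q v b (u ++ [:: (~~ q, true); (q, true)]) [::] d.
rewrite !cats0 -!catA /= => H; apply: iso_trans H _.
have := half_twist_absorbed b (u ++ [:: (~~ q, true), (q, true) & map swap v]) d.
rewrite -catA /=; apply: iso_trans.
(* [half_twist_absorbed] wants the half twist to end away from the cap. *)
case: (eqVneq q (~~ d)) => [-> | nq]; first exact: iso_refl.
have -> : q = d by move: nq; case: q; case: d.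
have := half_twist_swap d b (u ++ [:: (~~ d, true), (d, true) & map swap v]) [::] d.
by rewrite !cats0 -!catA.
Qed.

(** The continued fraction identity
    x + 1/(y + 1 + 1/w) = (x + 1) - 1/(2 - 1/(2 - ... - 1/(w + 1))), with [y]
    twos, where [w] is the fraction of [z :: m]: the entries that follow
    [x + 1] are the opposites of those of [untwist y z m]. *)
Fixpoint untwist (y : nat) (z : int) (m : seq int) : seq int :=
  if y is y'.+1 then 2%R :: map -%R%R (untwist y' z m) else (z + 1)%R :: m.

Lemma letters_opp p o m : letters p o (map -%R%R m) = letters p (~~ o) m.
Proof.
elim: m p o => //= a m IH p o.
rewrite abszN IH Num.Theory.oppr_gt0 Num.Theory.oppr_lt0.
by case: o.
Qed.

Lemma map_swap_letters p o m : map swap (letters p o m) = letters (~~ p) o m.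
Proof. by elim: m p o => //= a m IH p o; rewrite map_cat map_nseq IH. Qed.

(** The crossings to be resolved are treated from left to right; each of them
    exchanges the pairs of strands on its right, so that the next ones again lie
    opposite to the last letter produced, and moves the final cap. *)
Lemma untwist_iso b u p y (z : int) m d : (0 < z)%R ->
  iso (strip b (u ++ nseq y.+1 (~~ p, false) ++ letters p true (z :: m)) d)
      (strip b (u ++ (p, true) :: letters (~~ p) true (untwist y z m))
         (d (+) odd y.+1)).
Proof.
move=> z0; elim: y u p d => [|y IH] u p d.
  have := resolve_crossing b u (~~ p) (letters p true (z :: m)) d.
  rewrite negbK map_swap_letters addbT; congr iso; congr strip.
  rewrite [untwist _ _ _]/= /= z0 (_ : (0 < z + 1)%R = true); last by lia.
  by rewrite (_ : `|(z + 1)%R|%N = `|z|%N.+1); last by lia.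
apply: iso_trans (resolve_crossing _ u (~~ p)
                   (nseq y.+1 (~~ p, false) ++ letters p true (z :: m)) d) _.
have := IH (u ++ [:: (p, true); (~~ p, true)]) (~~ p) (~~ d).
rewrite map_cat map_nseq map_swap_letters /swap [(_, _).1]/= [(_, _).2]/=.
rewrite !negbK -!catA.
rewrite (_ : ~~ d (+) odd y.+1 = d (+) odd y.+2); last first.
  by rewrite /=; case: (d); case: (odd y).
rewrite [untwist y.+1 z m]/= [letters (~~ p) true (2%R :: _)]/=.
by rewrite letters_opp negbK.
Qed.

(** * Isotopies of closures *)

Lemma run_shift n k w :
  run n w = Some k -> run n.+1 (map (reposition S) w) = Some k.+1.
Proof.
elim: w n => [|e w IH] n /=; first by case=> ->.
have -> : pos (reposition S e) = (pos e).+1 by case: e.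
have -> : arity_in (reposition S e) = arity_in e by case: e.
have -> : arity_out (reposition S e) = arity_out e by case: e.
rewrite addSn ltnS; case: ifP => // le /IH <-; congr run; lia.
Qed.

Lemma closure_is_diagram w : is_diagram 1 1 w -> is_diagram 0 0 (link_closure w).
Proof. by rewrite /is_diagram /= run_cat => /run_shift ->. Qed.

Lemma planar_shift l r : planar_move l r ->
  planar_move (map (reposition S) l) (map (reposition S) r).
Proof.
case=> /= [e f ef|i|i|i s|i s];
  [|exact: zigzag_down|exact: zigzag_up|exact: tip_left|exact: tip_right].
have -> : reposition S (reposition (fun j => j - arity_out e + arity_in e) f) =
  reposition (fun j => j - arity_out (reposition S e) + arity_in (reposition S e))
    (reposition S f).
  by case: e f ef => [i|i|i s] [j|j|j t] /= ef; f_equal; lia.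
by apply: exchange; case: e f ef => [i|i|i s] [j|j|j t] /=.
Qed.

Lemma reidemeister_shift l r : reidemeister_move l r ->
  reidemeister_move (map (reposition S) l) (map (reposition S) r).
Proof.
by case=> /= *; [exact: R1_left|exact: R1_right|exact: R2|exact: R3].
Qed.

Lemma isotopic_closure v w :
  iso v w -> isotopic 0 0 (link_closure v) (link_closure w).
Proof.
elim=> {v w} [v w H|v|v w _ IH|v w z _ IH1 _ IH2]; first last.
- exact: rst_trans IH1 IH2.
- exact: rst_sym.
- exact: rst_refl.
apply: rst_step; case: H => p q l r lr /closure_is_diagram D /closure_is_diagram D'.
have E x : link_closure (p ++ x ++ q) =
    (Birth 0 :: map (reposition S) p) ++ map (reposition S) x
    ++ (map (reposition S) q ++ [:: Death 0]).
  by rewrite /link_closure !map_cat !catA.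
rewrite !E in D D' *; apply: Move D D'.
by case: lr => [/planar_shift|/reidemeister_shift]; [left|right].
Qed.

(** * Words without Reidemeister moves *)

Definition cancelling (l : seq letter) : bool :=
  if l is [:: x; y] then (x.1 == y.1) && (x.2 != y.2) else false.

(** The factors to which [R3] applies, in either direction. *)
Definition braidable (l : seq letter) : bool :=
  if l is [:: x; y; z] then
    [&& x.1 == z.1, x.1 != y.1 & (y.2 == x.2) || (y.2 == z.2)]
  else false.

Fixpoint tight (w : seq letter) : bool :=
  if w is x :: w' then
    [&& ~~ cancelling (take 2 w), ~~ braidable (take 3 w) & tight w']
  else true.

Lemma tight_catr u v : tight (u ++ v) -> tight v.
Proof. by elim: u => //= x u IH /and3P[_ _ /IH]. Qed.

Lemma cancelling_not_tight u x y v :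
  cancelling [:: x; y] -> ~~ tight (u ++ [:: x, y & v]).
Proof.
by move=> h; apply/negP => /tight_catr; rewrite /= take0 => /andP[/negP[]].
Qed.

Lemma braidable_not_tight u x y z v :
  braidable [:: x; y; z] -> ~~ tight (u ++ [:: x, y, z & v]).
Proof.
by move=> h; apply/negP => /tight_catr; rewrite /= !take0 => /and3P[_ /negP[]].
Qed.

(** * Slides *)

Lemma strip_split p e q b w d : p ++ e :: q = strip b w d ->
  [\/ [/\ p = [::], e = Birth b & q = map crossing w ++ [:: Death d]],
      (exists u x v, [/\ w = u ++ x :: v, p = Birth b :: map crossing u,
          e = crossing x & q = map crossing v ++ [:: Death d]]) |
      [/\ p = Birth b :: map crossing w, e = Death d & q = [::]]].
Proof.
case: p => [[-> ->]|e0 p [->]]; first by constructor 1.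
elim: w p => [|x w IH] [|e1 p] //=.
- by case=> -> ->; constructor 3.
- by case=> _; case: p.
- by case=> -> ->; constructor 2; exists [::], x, w.
case=> -> /IH[[//]|[u [y [v [-> [->] -> ->]]]]|[[->] -> ->]]; last by constructor 3.
by constructor 2; exists (x :: u), y, v.
Qed.

Lemma strip_pos p e q b w d : p ++ e :: q = strip b w d -> pos e <= 1.
Proof.
by case/strip_split=> [[_ -> _]|[u [x [v [_ _ -> _]]]]|[_ -> _]] /=; exact: leq_b1.
Qed.

(** Three strands leave no room for two events at disjoint heights: only a
    [Death] could come before a distant event, and it is the last event. *)
Lemma strip_no_exchange p e f q b w d : pos e + arity_out e <= pos f ->
  p ++ [:: e, f & q] <> strip b w d.
Proof.
move=> ef E.
have f1 : pos f <= 1 by apply: (@strip_pos (rcons p e) f q b w d); rewrite cat_rcons.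
case: (strip_split E) => [[_ Ee _]|[u [x [v [_ _ Ee _]]]]|[_ _ //]];
  by move: ef; rewrite Ee /=; lia.
Qed.

Definition is_birth (e : event) : bool := if e is Birth _ then true else false.

Lemma strip_births b w d : count is_birth (strip b w d) = 1.
Proof.
by rewrite /= count_cat count_map /= (eq_count (a2 := pred0)) ?count_pred0.
Qed.

(** What the first or last letter becomes when it slides through the tip of the
    adjacent cap. The words in [x] and [tip x] are also the alternating ones. *)
Definition tip (x : letter) : letter := (~~ x.1, ~~ x.2).

(** The ways in which a slide step can start at a strip. When a Reidemeister
    move is available its result does not matter, since such strips will be
    excluded. *)
Inductive slide_cases b w d : seq event -> Prop :=
  | NotTight v : ~~ tight w -> slide_cases b w d v
  | CurlL s w' v : w = (b, s) :: w' -> slide_cases b w d v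
  | CurlR s w' v : w = rcons w' (d, s) -> slide_cases b w d v
  | TipL x w' : w = x :: w' -> x.1 = ~~ b ->
      slide_cases b w d (strip (~~ b) (tip x :: w') d)
  | TipR x w' : w = rcons w' x -> x.1 = ~~ d ->
      slide_cases b w d (strip b (rcons w' (tip x)) (~~ d)).

Lemma strip_first p i e q b w d :
  p ++ [:: Birth i, e & q] = strip b w d -> is_cross e ->
  exists x w', [/\ w = x :: w', p = [::], i = b, e = crossing x
                 & q = map crossing w' ++ [:: Death d]].
Proof.
case/strip_split=> [[-> [->] E]|[u [x [v [_ _ //]]]]|[_ //]].
by case: w E => [[-> _]|x w [-> ->]] // _; exists x, w.
Qed.

Lemma strip_last p i e q b w d :
  p ++ [:: e, Death i & q] = strip b w d -> is_cross e ->
  exists x w', [/\ w = rcons w' x, p = Birth b :: map crossing w', i = d,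
                   e = crossing x & q = [::]].
Proof.
case/strip_split=> [[_ -> //]|[u [x [[|y v] [-> -> -> /= E]]]]|[_ -> //]] _; last by [].
by case: E => -> ->; exists x, u; rewrite cats1.
Qed.

Lemma strip_inner p e q b w d : p ++ e :: q = strip b w d -> is_cross e ->
  exists u x v, [/\ w = u ++ x :: v, p = Birth b :: map crossing u,
                    e = crossing x & q = map crossing v ++ [:: Death d]].
Proof. by case/strip_split=> [[_ -> //]|//|[_ -> //]]. Qed.

Lemma crossings_head f q d v :
  f :: q = map crossing v ++ [:: Death d] -> is_cross f ->
  exists y v', [/\ v = y :: v', f = crossing y
                 & q = map crossing v' ++ [:: Death d]].
Proof. by case: v => [[-> _]|y v [-> ->]] // _; exists y, v. Qed.

(** Both ends of a step are strips, which rules out exchanges on either side and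
    zigzags, as these change the number of births. The number of crossings does
    not increase, so curls and cancelling pairs are never created. *)
Lemma slide_stepP b w d v : slide_step (strip b w d) v -> slide_cases b w d v.
Proof.
case=> _ /trigonal_strip[b' [w' [d' ->]]] mv nc.
have [p [q [l [r [lr E E']]]]] : exists p q l r,
  [/\ (planar_move l r \/ reidemeister_move l r) \/
      (planar_move r l \/ reidemeister_move r l),
    p ++ l ++ q = strip b w d & p ++ r ++ q = strip b' w' d'].
  by case: mv => /[dup] H; case E1: _ _ / H => [p q l r lr _ _];
  [exists p, q, l, r|exists p, q, r, l]; split=> //; [left|right].
have {mv}nc : ncross r <= ncross l.
  by move: nc; rewrite -E -E' /ncross !count_cat; lia.
have births : count is_birth l = count is_birth r.
  have := strip_births b w d.
  by rewrite -(strip_births b' w' d') -E -E' !count_cat; lia.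
have nex e f : pos e + arity_out e <= pos f -> r ++ q <> [:: e, f & q].
  by move=> ef rE; move: E'; rewrite rE; exact: strip_no_exchange.
rewrite -E' {b' w' d' E'}.
case: lr => [[]|[]] m; case: m E nc births nex => /=.
- by move=> e f ef /(strip_no_exchange ef).
- by [].
- by [].
- move=> i s /strip_first[//|x [w' [-> -> -> [xi ->] ->]]] _ _ _.
  by case: x b xi => -[] t [] //= _; exact: (@TipL false _ d (true, t) w').
- move=> i s /strip_last[//|x [w' [-> -> -> [xi ->] ->]]] _ _ _.
  case: x d xi => -[] t [] //= _; have := @TipR b _ false (true, t) w' erefl erefl.
  by rewrite /strip map_rcons cat_rcons.
- move=> i s /strip_first[//|x [w' [-> -> -> [xi _] ->]]] _ _ _.
  by apply: (@CurlL _ _ _ x.2 w'); case: x b xi => -[] t [].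
- move=> i s /strip_last[//|x [w' [-> -> -> [xi _] ->]]] _ _ _.
  by apply: (@CurlR _ _ _ x.2 w'); case: x d xi => -[] t [].
- move=> i s /strip_inner[//|u [[x1 x2] [t1 [-> _ [xi xs] /=]]]].
  case/crossings_head=> // -[y1 y2] [t2 [-> [yi ys] _]] _ _ _.
  apply: NotTight; apply: cancelling_not_tight.
  rewrite /= -xs -ys; move: yi; rewrite xi.
  by case: x1 y1 s {xi xs ys} => [] [] [].
- move=> i a c e cyc /strip_inner[//|u [[x1 x2] [t1 [-> _ [xi xs] /=]]]].
  case/crossings_head=> // -[y1 y2] [t2 [-> [yi ys] /=]].
  case/crossings_head=> // -[z1 z2] [t3 [-> [zi zs] _]] _ _ _.
  apply: NotTight; apply: braidable_not_tight; rewrite /= -xs -ys -zs cyc andbT.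
  by move: xi yi zi => -> + /esym; case: x1 y1 z1 => [] [] [].
- by move=> e f ef _ _ _ /(_ e f ef).
- by [].
- by [].
- move=> i s /strip_first[//|x [w' [-> -> + [xi xs] ->]]] _ _ _.
  case: x b xi xs => -[] t [] //= -> // <- _.
  have := @TipL true _ d (false, ~~ s) w' erefl erefl.
  by rewrite /tip /= negbK.
- move=> i s /strip_last[//|x [w' [-> -> + [xi xs] ->]]] _ _ _.
  case: x d xi xs => -[] t [] //= -> // <- _.
  have := @TipR b _ true (false, ~~ s) w' erefl erefl.
  by rewrite /strip map_rcons cat_rcons /tip /= negbK.
- by [].
- by [].
- by [].
- move=> i a c e cyc /strip_inner[//|u [[x1 x2] [t1 [-> _ [xi xs] /=]]]].
  case/crossings_head=> // -[y1 y2] [t2 [-> [yi ys] /=]].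
  case/crossings_head=> // -[z1 z2] [t3 [-> [zi zs] _]] _ _ _.
  apply: NotTight; apply: braidable_not_tight; rewrite /= -xs -ys -zs orbC cyc andbT.
  by move: xi yi zi => + -> /esym; case: x1 y1 z1 => [] [] [].
Qed.

(** * The word of the awkward diagram *)

Lemma tight_alternating x w : all (mem [:: x; tip x]) w -> tight w.
Proof.
elim: w => //= y w IH /andP[xy aw]; rewrite IH // andbT {IH}.
case: w aw => [|z w] //= /andP[xz]; rewrite take0 => aw.
apply/andP; split.
  move: xy xz {aw}; rewrite !inE.
  by case: x => [] [] []; case: y => [] [] []; case: z => [] [] [].
case: w aw => [|t w] //= /andP[xt _]; rewrite take0.
move: xy xz xt; rewrite !inE.
by case: x => [] [] []; case: y => [] [] [];
   case: z => [] [] []; case: t => [] [] [].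
Qed.

(** [y + 1] squares; those of index less than [y] come from entries 2, the last
    one starts the power that ends the positive part. *)
Fixpoint squares (p : bool) (y : nat) : seq letter :=
  [:: (p, true), (p, true) & if y is y'.+1 then squares (~~ p) y' else [::]].

Lemma squares_cons p y : exists w, squares p y = [:: (p, true), (p, true) & w].
Proof. by case: y => [|y]; eexists. Qed.

Lemma letters_untwist p y (z : int) m : (0 < z)%R ->
  letters p true (untwist y z m) =
  squares p y ++ nseq `|z|.-1 (p (+) odd y, true) ++ letters (~~ (p (+) odd y)) false m.
Proof.
move=> z0; elim: y p => [|y IH] p /=.
  rewrite (_ : (0 < z + 1)%R = true); last by lia.
  by rewrite (_ : `|(z + 1)%R|%N = `|z|.-1.+2) ?addbF; last by lia.
by rewrite letters_opp IH addNb addbN.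
Qed.

Lemma all_letters p o (x : letter) m : all (fun a => 0 < a)%R m ->
  x \in [:: (p, o); (~~ p, ~~ o)] -> all (mem [:: x; tip x]) (letters p o m).
Proof.
elim: m p o => //= a m IH p o /andP[a0 m0] xp.
rewrite all_cat IH //; last by move: xp; rewrite !inE !negbK orbC.
rewrite all_nseq andbT; apply/orP; right.
rewrite (_ : (if o then _ else _) = o); last by move: a0; case: (o) => //; lia.
by move: xp; rewrite !inE; case: (x) => [] [] []; case: (p); case: (o).
Qed.

Lemma last_letters o p x m : all (fun a => 0 < a)%R m -> x.1 = ~~ p ->
  (last x (letters p o m)).1 = ~~ p (+) odd (size m).
Proof.
elim: m o p x => /= [|a m IH] o p x; first by rewrite addbF.
case/andP=> a0 m0 xp; rewrite last_cat (_ : `|a|%N = `|a|.-1.+1); last by lia.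
set y := (_, _); rewrite (_ : last x (nseq _ y) = y); last by elim: (_.-1) => //=.
by rewrite IH /= ?negbK // addbN addNb ?negbK.
Qed.

Lemma tight_squares p y t : let x := (p (+) odd y, true) in
  all (mem [:: x; tip x]) t -> tight (squares p y ++ t).
Proof.
elim: y p => [|y IH] p x al.
  apply: (@tight_alternating (p, true)); move: al; rewrite /x addbF /= => ->.
  by rewrite !inE eqxx.
have /= := IH (~~ p); rewrite addNb -addbN => /(_ al).
have [w ->] := squares_cons (~~ p) y; rewrite /= take0 => ->.
by case: (p).
Qed.

(** The letter [e] before [n + 2 >= 2] letters [p] may be tipped: the exponent
    keeps the tipped letter away from the next power, so that no letter gets
    isolated between two letters of the other kind. *)
Lemma tight_core e p n y t : let x := (~~ p (+) odd y, true) in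
  e \in [:: (p, true); tip (p, true)] -> all (mem [:: x; tip x]) t ->
  tight (e :: nseq n.+2 (p, true) ++ squares (~~ p) y ++ t).
Proof.
move=> /= ep al.
have T : tight (nseq n.+2 (p, true) ++ squares (~~ p) y ++ t).
  elim: n => [|n] /=.
    have := tight_squares al; have [w ->] := squares_cons (~~ p) y.
    by rewrite /= take0 => ->; case: (p).
  by rewrite !take0 => ->; rewrite /= eqxx.
move: T => /= ->; rewrite take0 andbT.
by move: ep; rewrite !inE; case: e => [] [] []; case: (p).
Qed.

(** * The slide orbit *)

(** The caps are placed so that the first and the last crossing are not curls;
    tipping a letter moves the cap along, which preserves this. *)
Definition ends_tipped (x : letter) (mid : seq letter) (z : letter)
    (v : seq event) : Prop :=
  exists x' z', [/\ x' \in [:: x; tip x], z' \in [:: z; tip z]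
    & v = strip (~~ x'.1) (x' :: rcons mid z') (~~ z'.1)].

Lemma tipK x : tip (tip x) = x.
Proof. by case: x => a b; rewrite /tip /= !negbK. Qed.

Lemma tip_mem x x' : x' \in [:: x; tip x] -> tip x' \in [:: x; tip x].
Proof. by rewrite !inE => /orP[] /eqP ->; rewrite ?tipK eqxx ?orbT. Qed.

Lemma slide_tight x mid z v w :
  (forall x' z', x' \in [:: x; tip x] -> z' \in [:: z; tip z] ->
     tight (x' :: rcons mid z')) ->
  ends_tipped x mid z v -> slide_isotopy v w -> ends_tipped x mid z w.
Proof.
move=> T + vw; elim: vw => {v w} [v w|//|v w u _ IH1 _ IH2 /IH1 /IH2 //].
move=> st [x' [z' [xx zz E]]]; move: st; rewrite E => /slide_stepP.
case E2: _ / => [u nt|s w' u [e _]|s w' u e|y w' [<- <-] _|y w' e _].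
- by rewrite T in nt.
- by move: e; case: (x') => [] [] [].
- by move: e; rewrite -rcons_cons => /rcons_inj[_]; case: (z') => [] [] [].
- by exists (tip x'), z'; split=> //; exact: tip_mem.
- move: e; rewrite -rcons_cons => /rcons_inj[<- <-].
  by exists x', (tip z'); split=> //; exact: tip_mem.
Qed.

Lemma slide_isotopy_iso v w : slide_isotopy v w -> iso v w.
Proof.
elim=> {v w} [v w [_ _ [] H _]|v|v w z _ + _]; last exact: rst_trans.
- exact: rst_step.
- exact/rst_sym/rst_step.
exact: rst_refl.
Qed.

(** The edge that joins the two crossings passes over at both, or under at
    both. *)
Lemma not_alternating b u q v d :
  ~ alternating (strip b (u ++ [:: (q, true), (~~ q, true) & v]) d).
Proof.
set w := strip _ _ _; set t := (size u).+1.
have [E1 E2] : onth w t = Some (Cross q true) /\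
    onth w t.+1 = Some (Cross (~~ q) true).
  rewrite /w /strip /t !map_cat -catA /= -[size u](size_map crossing).
  by elim: (map _ _).
clearbody w; case: q E1 E2 => E1 E2 /(_ ((t.+1, 1), true) ((t.+1, 1), false)).
  move=> /(_ _ _ (leave_upper E1) (enter_lower E2)); apply=> //; exact: rst_refl.
move=> /(_ _ _ (leave_lower E1) (enter_upper E2)); apply=> //; exact: rst_refl.
Qed.

(** A diagram of minimal complexity in the slide orbit is simple, because the
    orbits of its elements lie in that orbit. *)
Lemma awkward_of_orbit D :
  (forall E, slide_isotopy (diagram D) (diagram E) -> ~ alternating (diagram E)) ->
  exists E, slide_isotopy (diagram D) (diagram E) /\ awkward E.
Proof.
move=> na.
suff : exists E, slide_isotopy (diagram D) (diagram E) /\ simple E.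
  by case=> E [DE sE]; exists E; split=> //; split=> //; apply: na.
elim/ltn_ind: {D na}(complexity D) {-2}D (erefl (complexity D)) => n IH D cD.
have [sD|] := classic (simple D); first by exists D; split=> //; apply: rt_refl.
move=> nD; apply: NNPP => nE; apply: nD => E DE; rewrite leqNgt; apply/negP => lt.
rewrite cD in lt; have [F [EF sF]] := IH _ lt _ erefl.
by apply: nE; exists F; split=> //; apply: rt_trans EF.
Qed.

Lemma size_untwist y z m : size (untwist y z m) = y.+1 + size m.
Proof. by elim: y => //= y IH; rewrite size_map IH. Qed.

Theorem proposition5p1 (K : link) (m : seq int) :
  (3 <= size m)%N ->
  all (fun a => 0 < a)%R m ->
  (2 <= head 0 m)%R ->
  (2 <= last 0 m)%R ->
  conway_normal_form K m ->
  exists D : trigonal, possesses K D /\ awkward D.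
Proof.
case: m => [|m1 [|m2 [|m3 m]]] // _ /and4P[m1_gt0 m2_gt0 m3_gt0 m_gt0] /=.
move=> m1_ge2 m_last [_ [f KD]].
pose y := `|m2|.-1.
pose D := Trigonal f ((m1 + 1)%R :: map -%R%R (untwist y m3 m)).
have DE : diagram D = strip (~~ f)
    (nseq `|m1| (f, true) ++ (f, true) :: letters (~~ f) true (untwist y m3 m))
    (f (+) odd (size m).+1 (+) odd y.+1).
  rewrite diagramE /= letters_opp size_map size_untwist.
  rewrite (_ : (0 < m1 + 1)%R = true); last by lia.
  rewrite (_ : `|(m1 + 1)%R|%N = `|m1| + 1); last by lia.
  rewrite nseqD -catA.
  by congr strip; rewrite oddD /=; case: (f); case: (odd y); case: (odd _).
have KD' : possesses K D.
  apply: rst_trans KD _; apply: isotopic_closure.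
  have := untwist_iso (~~ f) (nseq `|m1| (f, true)) f y m
            (f (+) odd (size m).+1) m3_gt0.
  rewrite DE diagramE /= m1_gt0 m3_gt0 (_ : (m2 < 0)%R = false) ?negbK; last by lia.
  by rewrite (_ : `|m2|%N = y.+1) //; rewrite /y; lia.
(* The last square is made of two letters [x]; [t] is what follows it. *)
pose x := (~~ f (+) odd y, true).
pose t := nseq `|m3|.-1 x ++ letters (~~ x.1) false m.
have al : all (mem [:: x; tip x]) t.
  rewrite all_cat all_nseq all_letters ?andbT //=; first by rewrite mem_head orbT.
  by rewrite !inE /x /= negbK; case: (_ (+) _).
have tE : letters (~~ f) true (untwist y m3 m) = squares (~~ f) y ++ t.
  exact: letters_untwist.
have zE : (last x t).1 = x.1 (+) odd (size m).
  rewrite /t last_cat (_ : last x (nseq _ x) = x); last by elim: (_.-1).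
  by rewrite (last_letters false (p := ~~ x.1)) ?negbK.
(* For three entries this is the hypothesis that the last one is at least 2. *)
have : t != [::].
  rewrite /t; case: (m) m_gt0 m_last => [_ /= m3_ge2|a m' /= /andP[a_gt0 _] _].
    by rewrite (_ : `|m3|.-1 = `|m3|.-2.+1); last by lia.
  by rewrite (_ : `|a|%N = `|a|.-1.+1); [case: nseq | lia].
case/lastP: t tE al zE => [//|t z] tE al; rewrite last_rcons => zE _.
pose mid := nseq `|m1| (f, true) ++ squares (~~ f) y ++ t.
have orbit : ends_tipped (f, true) mid z (diagram D).
  exists (f, true), z; split; rewrite ?inE ?eqxx // DE tE zE /mid.
  have -> w : nseq `|m1| (f, true) ++ (f, true) :: w =
              (f, true) :: nseq `|m1| (f, true) ++ w.
    by elim: `|m1|%N => //= n ->.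
  rewrite !rcons_cat; congr strip.
  by rewrite /x /=; case: (f); case: (odd y); case: (odd _).
have T x' z' : x' \in [:: (f, true); tip (f, true)] -> z' \in [:: z; tip z] ->
    tight (x' :: rcons mid z').
  move=> xx zz; rewrite /mid !rcons_cat (_ : `|m1|%N = `|m1|.-2.+2); last by lia.
  apply: tight_core => //; move: al; rewrite !all_rcons => /andP[zx ->]; rewrite andbT.
  move: zz zx; rewrite !inE => /orP[] /eqP -> // /orP[] /eqP ->;
  by rewrite ?tipK eqxx ?orbT.
have [E [DEiso awk]] :
    exists E, slide_isotopy (diagram D) (diagram E) /\ awkward E.
  apply: awkward_of_orbit => E /(slide_tight T orbit)[x' [z' [_ _ ->]]].
  (* The first letter may be tipped, so the factor ab is taken after it. *)
  rewrite /mid (_ : `|m1|%N = `|m1|.-1 + 1); last by lia.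
  have [w ->] := squares_cons (~~ f) y.
  rewrite nseqD -!catA !rcons_cat -cat_cons; exact: not_alternating.
exists E; split=> //; apply: rst_trans KD' _; apply: isotopic_closure.
exact: slide_isotopy_iso.
Qed.
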